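(* Let $(\mathbf{v},\mathbf{R})$ be a vector-relation configuration on a planar bipartite graph $G$, and let $(\mathbf{v}',\mathbf{R}')$ on $G'$ be obtained from it by a local transformation of vector-relation configurations (urban renewal or degree two vertex addition, in either direction). Then the associated edge-weight functions on $G$ and on $G'$ are related (as gauge classes) by the corresponding classical local transformation of the dimer model.
   Context: Vector-relation configuration on a planar bipartite graph $G=(B\cup W,E)$: a nonzero vector $v_w$ in a fixed vector space $V$ for each $w\in W$, and for each $b\in B$ a non-trivial linear relation $R_b$ among $\{v_w: w\in N(b)\}$, where $N(b)$ is the set of neighbors of $b$. $K_{bw}$ is the coefficient of $v_w$ in $R_b$ (assumed nonzero on edges). Gauge transformation by $\lambda\neq 0$: at $b\in B$, scale $R_b$ by $\lambda$; at $w\in W$, scale $v_w$ by $1/\lambda$ and the coefficient of $v_w$ by $\lambda$ in each relation where it appears. For edge weights, a gauge transformation at a vertex multiplies the weights of all edges at that vertex by a common nonzero scalar. All local transformations are considered on gauge classes. Associated weights. Kasteleyn signs are $\epsilon:E\to\{\pm1\}$ such that every bounded $4k$-gon face has an odd number of $-1$'s and every bounded $(4k+2)$-gon face an even number of $-1$'s on its boundary. Two choices differ by a gauge transformation. The weight function of a configuration is $\mathrm{wt}(\overline{bw})=\epsilon_{bw}K_{bw}$, well-defined up to gauge. Urban renewal, graph. Let $F$ be a quadrilateral face with white vertices $w_1,w_2$ and black vertices $b_1,b_2$. Delete the four edges of $F$; add white vertices $x_1,x_2$ and black vertices $s_1,s_2$; add edges $\overline{b_ix_i}$, $\overline{w_is_i}$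 and all four edges $\overline{x_is_j}$, so that $x_1,s_1,x_2,s_2$ bound a smaller quadrilateral inside $F$. Classical weights: if $\overline{b_1w_1},\overline{b_2w_1},\overline{b_2w_2},\overline{b_1w_2}$ have weights $a,b,c,d$, then with $\Delta=ac+bd\neq0$ the new weights are $a/\Delta$ on $\overline{s_2x_2}$, $b/\Delta$ on $\overline{s_2x_1}$, $c/\Delta$ on $\overline{s_1x_1}$, $d/\Delta$ on $\overline{s_1x_2}$, and $1$ on $\overline{b_ix_i},\overline{w_is_i}$; other weights are unchanged. Configurations: put $v_i=v_{w_i}$, let $u_i$ be the part of $R_{b_i}$ supported on $v_1,v_2$ (evaluated as a vector), and place $u_i$ at $x_i$. Assuming the $2\times2$ coefficient matrix expressing $(u_1,u_2)$ in terms of $(v_1,v_2)$ is nonsingular, solve formally for $v_i$ in terms of $u_1,u_2$ and move the $u_j$ terms to the other side to get the relation at $s_i$ (with coefficient $1$ on $v_i$). In $R_{b_i}$ replace the part supported on $v_1,v_2$ by $1\cdot u_i$. Degree two vertex addition, graph. A vertex is split into two vertices of the same color joined through a new degree two vertex of the opposite color, with its neighbors partitioned into two cyclically consecutive blocks distributed to the two copies. Classical weights: the two new edges have weight $1$, others are unchanged. Configurations: if the new vertex is black, the two copies of the split white vertex carry the same vector $u$ as before, the new black vertex carries the relation $1v-1w$ (where $v=w=u$ are the two copies), and the other relations are unchanged. If the new vertex is white and the split black vertex has relation $R$ among $u_1,\dots,u_k,v_1,\dots,v_l$ (the two blocks), the new vector is $w=R|_{u_1\cdots u_k}=-R|_{v_1\cdots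 v_l}$ (where $R|_{u_1\cdots u_k}$ is the part of $R$ supported on $u_1,\dots,u_k$); the two new black vertices carry the relations obtained from $R$ by replacing $R|_{v_1\cdots v_l}$ with $-1w$, respectively $R|_{u_1\cdots u_k}$ with $1w$. Both transformations may be applied in reverse after suitable gauge transformations. *)

(* Defs.v *)
From mathcomp Require Import all_boot all_order all_algebra.

Set Implicit Arguments.
Unset Strict Implicit.
Unset Printing Implicit Defensive.

Import GRing.Theory.
Local Open Scope ring_scope.

(* An embedded finite simple bipartite graph is given by its rotation system:
   [rotB b w] (resp. [rotW w b]) is the neighbour that follows [w] around [b]
   (resp. [b] around [w]) in CLOCKWISE order.  [lface b w] is the face on the
   left of the edge travelled from [b] to [w].  The graph may be disconnected,
   so several boundary walks may belong to the same face; this is why the faces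
   are part of the data.  [rotB], [rotW], [lface] are only meaningful on
   edges. *)
Record bimap := Bimap {
  black : finType;
  white : finType;
  adj : black -> white -> bool;
  rotB : black -> white -> white;
  rotW : white -> black -> black;
  face : finType;
  lface : black -> white -> face;
  outer : face
}.

Arguments adj {G} : rename.
Arguments rotB {G} : rename.
Arguments rotW {G} : rename.
Arguments lface {G} : rename.
Arguments outer {G} : rename.

Section Planarity.
Variable G : bimap.

(* With clockwise rotations, a walk that arrives at [b] from [w] and keeps its
   face on the left leaves [b] towards [rotB b w]. *)
Definition rface (b : black G) (w : white G) : face G := lface b (rotB b w).

Definition edges : {set black G * white G} := [set e | adj e.1 e.2].

Definition vertex_rel : rel (black G + white G) := fun x y =>
  match x, y with
  | inl b, inr w | inr w, inl b => adj b w
  | _, _ => false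
  end.

Definition dual_rel : rel (face G) := fun f f' =>
  [exists e in edges,
     ((lface e.1 e.2 == f) && (rface e.1 e.2 == f')) ||
     ((lface e.1 e.2 == f') && (rface e.1 e.2 == f))].

(* Planarity is Euler's formula V - E + F = C + 1, where C is the number of
   connected components (isolated vertices included), together with
   connectedness of the dual graph.  When G is connected this says that the
   rotation system has genus 0 and that faces are exactly its boundary walks;
   in general it says that the genus 0 components are glued along faces in a
   tree-like way, i.e. that the surface obtained is a sphere. *)
Record planar : Prop := Planar {
  rotB_cyclic : forall (b : black G) (w : white G),
    adj b w -> fconnect (rotB b) w =i [pred w' | adj b w'];
  rotW_cyclic : forall (b : black G) (w : white G),
    adj b w -> fconnect (rotW w) b =i [pred b' | adj b' w];
  face_walk : forall (b : black G) (w : white G),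
    adj b w -> rface (rotW w b) w = lface b w;
  dual_connected : forall f f' : face G, connect dual_rel f f';
  euler_formula :
    (#|black G| + #|white G| + #|face G|
       = #|edges| + n_comp vertex_rel predT + 1)%N
}.

(* Number of sides of a face: an edge with the same face on both sides is
   counted twice. *)
Definition degree (f : face G) : nat :=
  (#|[set e in edges | lface e.1 e.2 == f]|
   + #|[set e in edges | rface e.1 e.2 == f]|)%N.

(* [eps b w = true] encodes the sign -1, [eps b w = false] the sign +1. *)
Definition minus_signs (eps : black G -> white G -> bool) (f : face G) : nat :=
  (#|[set e in edges | (lface e.1 e.2 == f) && eps e.1 e.2]|
   + #|[set e in edges | (rface e.1 e.2 == f) && eps e.1 e.2]|)%N.

Definition kasteleyn (eps : black G -> white G -> bool) : Prop :=
  forall f : face G, f != outer ->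
    (degree f = 0 %[mod 4] -> odd (minus_signs eps f)) /\
    (degree f = 2 %[mod 4] -> ~~ odd (minus_signs eps f)).

End Planarity.

Arguments kasteleyn {G} eps.

Record plane_graph := PlaneGraph {
  bimap_of :> bimap;
  plane_graphP : planar bimap_of
}.

Record configuration (k : fieldType) (V : lmodType k) (G : bimap) :=
  Configuration {
  vec : white G -> V;
  coef : black G -> white G -> k;
  vec_neq0 : forall w : white G, vec w != 0;
  coef_neq0 : forall (b : black G) (w : white G), (coef b w != 0) = adj b w;
  relation_nontrivial : forall b : black G, exists w : white G, coef b w != 0;
  relation_holds : forall b : black G, \sum_w coef b w *: vec w = 0
}.

Definition gauge_config (k : fieldType) (V : lmodType k) (G : bimap)
    (c c' : configuration V G) : Prop :=
  exists (g : black G -> k) (h : white G -> k),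
    [/\ forall b, g b != 0,
        forall w, h w != 0,
        forall w, vec c' w = (h w)^-1 *: vec c w
      & forall b w, coef c' b w = g b * h w * coef c b w].

(* Only the values on edges are meaningful. *)
Definition weight (k : fieldType) (G : bimap) := black G -> white G -> k.

Definition gauge_weight (k : fieldType) (G : bimap) (wt wt' : weight k G) : Prop :=
  exists (g : black G -> k) (h : white G -> k),
    [/\ forall b, g b != 0,
        forall w, h w != 0
      & forall b w, adj b w -> wt' b w = g b * h w * wt b w].

(* [wt] belongs to the gauge class of weights associated with [c]. *)
Definition associated_weight (k : fieldType) (V : lmodType k) (G : bimap)
    (c : configuration V G) (wt : weight k G) : Prop :=
  exists2 eps : black G -> white G -> bool,
    kasteleyn eps &
    gauge_weight (fun b w => (-1) ^+ eps b w * coef c b w) wt.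

Definition sum_elim (A B C : Type) (f : A -> C) (g : B -> C) (x : A + B) : C :=
  match x with inl a => f a | inr b => g b end.

(* Urban renewal.  The subscripts 1, 2 are the elements of ['I_2], and [rev_ord]
   exchanges them.  The white vertices are numbered so that b_1, w_1, b_2, w_2 is
   the order in which the boundary of F is followed with F on the left; this is
   no restriction, since exchanging w_1 with w_2 (and s_1 with s_2) does not
   affect the transformation. *)
Section UrbanRenewal.
Variables G G' : bimap.

Definition quad_edge (b : 'I_2 -> black G) (w : 'I_2 -> white G)
    (b0 : black G) (w0 : white G) : bool :=
  (b0 \in codom b) && (w0 \in codom w).

Record urban_renewal := UrbanRenewal {
  ur_b : 'I_2 -> black G;
  ur_w : 'I_2 -> white G;
  ur_F : face G;
  ur_oldB : black G -> black G';
  ur_oldW : white G -> white G';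
  ur_oldF : face G -> face G';
  ur_s : 'I_2 -> black G';
  ur_x : 'I_2 -> white G';
  ur_b_inj : injective ur_b;
  ur_w_inj : injective ur_w;
  ur_adj_bw : forall i j, adj (ur_b i) (ur_w j);
  ur_rotW_F : forall i, rotW (ur_w i) (ur_b i) = ur_b (rev_ord i);
  ur_rotB_F : forall i, rotB (ur_b (rev_ord i)) (ur_w i) = ur_w (rev_ord i);
  ur_lface_F : forall b w, adj b w ->
        (lface b w == ur_F) = [exists i, (b == ur_b i) && (w == ur_w i)];
  ur_F_bounded : ur_F != outer;
  (* [ur_oldF ur_F] is the smaller quadrilateral. *)
  ur_black_bij : bijective (sum_elim ur_oldB ur_s);
  ur_white_bij : bijective (sum_elim ur_oldW ur_x);
  ur_face_bij : bijective ur_oldF;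
  ur_outer : outer = ur_oldF outer;
  ur_adj_old : forall b w, adj (ur_oldB b) (ur_oldW w) = adj b w && ~~ quad_edge ur_b ur_w b w;
  ur_adj_x : forall b i, adj (ur_oldB b) (ur_x i) = (b == ur_b i);
  ur_adj_s : forall i w, adj (ur_s i) (ur_oldW w) = (w == ur_w i);
  ur_adj_sx : forall i j, adj (ur_s i) (ur_x j);
  (* Rotations of G': around b_i the consecutive neighbours w_1, w_2 are replaced
     by x_i, and around w_i the consecutive neighbours b_1, b_2 by s_i. *)
  ur_rotB_old : forall b w, adj b w -> b \notin codom ur_b ->
        rotB (ur_oldB b) (ur_oldW w) = ur_oldW (rotB b w);
  ur_rotB_b : forall i,
        let nbr w := if w \in codom ur_w then ur_x i else ur_oldW w in
        forall w, adj (ur_b i) w -> w != ur_w (rev_ord i) ->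
          rotB (ur_oldB (ur_b i)) (nbr w) = nbr (rotB (ur_b i) w);
  ur_rotW_old : forall b w, adj b w -> w \notin codom ur_w ->
        rotW (ur_oldW w) (ur_oldB b) = ur_oldB (rotW w b);
  ur_rotW_w : forall i,
        let nbr b := if b \in codom ur_b then ur_s i else ur_oldB b in
        forall b, adj b (ur_w i) -> b != ur_b i ->
          rotW (ur_oldW (ur_w i)) (nbr b) = nbr (rotW (ur_w i) b);
  ur_rotW_x : forall i, [/\ rotW (ur_x i) (ur_oldB (ur_b i)) = ur_s (rev_ord i),
                    rotW (ur_x i) (ur_s (rev_ord i)) = ur_s i
                  & rotW (ur_x i) (ur_s i) = ur_oldB (ur_b i)];
  ur_rotB_s : forall i, [/\ rotB (ur_s i) (ur_oldW (ur_w i)) = ur_x i,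
                    rotB (ur_s i) (ur_x i) = ur_x (rev_ord i)
                  & rotB (ur_s i) (ur_x (rev_ord i)) = ur_oldW (ur_w i)];
  ur_lface_old : forall b w, adj b w -> ~~ quad_edge ur_b ur_w b w ->
        lface (ur_oldB b) (ur_oldW w) = ur_oldF (lface b w);
  ur_lface_small : forall i, lface (ur_s i) (ur_x (rev_ord i)) = ur_oldF ur_F;
  ur_lface_sx : forall i, lface (ur_s i) (ur_x i) = ur_oldF (rface (ur_b i) (ur_w i));
  ur_lface_bx : forall i, lface (ur_oldB (ur_b i)) (ur_x i)
                  = ur_oldF (lface (ur_b i) (ur_w (rev_ord i)));
  ur_lface_sw : forall i, lface (ur_s i) (ur_oldW (ur_w i))
                  = ur_oldF (lface (ur_b (rev_ord i)) (ur_w i))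
}.

Variable D : urban_renewal.
Let b := ur_b D.
Let w := ur_w D.
Let oldB := ur_oldB D.
Let oldW := ur_oldW D.
Let s := ur_s D.
Let x := ur_x D.

Section Weights.
Variable k : fieldType.

Definition urban_renewal_weight (wt : weight k G) (wt' : weight k G') : Prop :=
  let Delta := wt (b ord0) (w ord0) * wt (b ord_max) (w ord_max)
               + wt (b ord_max) (w ord0) * wt (b ord0) (w ord_max) in
  [/\ Delta != 0,
      forall i j, wt' (s i) (x j) = wt (b (rev_ord j)) (w (rev_ord i)) / Delta,
      forall i, wt' (oldB (b i)) (x i) = 1,
      forall i, wt' (s i) (oldW (w i)) = 1
    & forall b0 w0, adj b0 w0 -> ~~ quad_edge b w b0 w0 ->
        wt' (oldB b0) (oldW w0) = wt b0 w0].

End Weights.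

Section Configurations.
Variables (k : fieldType) (V : lmodType k).

(* Coefficients on non-edges of G' vanish by [coef_neq0]. *)
Definition urban_renewal_config
    (c : configuration V G) (c' : configuration V G') : Prop :=
  let M : 'M[k]_2 := \matrix_(i, j) coef c (b i) (w j) in
  [/\ M \in unitmx,
      (forall w0, vec c' (oldW w0) = vec c w0) /\
      (forall i, vec c' (x i) = \sum_j M i j *: vec c (w j)),
      forall i, coef c' (s i) (oldW (w i)) = 1 /\
        forall j, coef c' (s i) (x j) = - invmx M i j,
      forall i, coef c' (oldB (b i)) (x i) = 1
    & forall b0 w0, adj b0 w0 -> ~~ quad_edge b w b0 w0 ->
        coef c' (oldB b0) (oldW w0) = coef c b0 w0].

End Configurations.
End UrbanRenewal.

(* Degree two vertex addition with a new black vertex [ws_new].  The white vertex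
   [ws_split] is split: its neighbours, in clockwise order, are
   [ws_block1 ++ ws_block2]; the first block is given to [ws_old ws_split], the
   second one to [ws_copy].  The faces along the edges at [ws_new] are forced by
   [face_walk]. *)
Section WhiteSplit.
Variables G G' : bimap.

Record white_split := WhiteSplit {
  ws_split : white G;
  ws_block1 : seq (black G);
  ws_block2 : seq (black G);
  ws_oldB : black G -> black G';
  ws_oldW : white G -> white G';
  ws_oldF : face G -> face G';
  ws_new : black G';
  ws_copy : white G';
  (* the endpoint in G' of the edge coming from [adj b w] *)
  ws_end := fun (b : black G) (w : white G) =>
    if (w == ws_split) && (b \in ws_block2) then ws_copy else ws_oldW w;
  ws_blocks_uniq : uniq (ws_block1 ++ ws_block2);
  ws_blocks_adj : ws_block1 ++ ws_block2 =i [pred b | adj b ws_split];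
  ws_blocks_clockwise : fcycle (rotW ws_split) (ws_block1 ++ ws_block2);
  ws_black_bij : bijective (oapp ws_oldB ws_new);
  ws_white_bij : bijective (oapp ws_oldW ws_copy);
  ws_face_bij : bijective ws_oldF;
  ws_outer : outer = ws_oldF outer;
  ws_adj_old : forall b w, w != ws_split -> adj (ws_oldB b) (ws_oldW w) = adj b w;
  ws_adj_block1 : forall b, adj (ws_oldB b) (ws_oldW ws_split) = (b \in ws_block1);
  ws_adj_block2 : forall b, adj (ws_oldB b) ws_copy = (b \in ws_block2);
  ws_adj_new : forall w, adj ws_new (ws_oldW w) = (w == ws_split);
  ws_adj_new_copy : adj ws_new ws_copy;
  ws_rot_block1 : fcycle (rotW (ws_oldW ws_split)) (ws_new :: map ws_oldB ws_block1);
  ws_rot_block2 : fcycle (rotW ws_copy) (ws_new :: map ws_oldB ws_block2);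
  ws_rot_new : fcycle (rotB ws_new) [:: ws_oldW ws_split; ws_copy];
  ws_rotW_old : forall b w, adj b w -> w != ws_split ->
        rotW (ws_oldW w) (ws_oldB b) = ws_oldB (rotW w b);
  ws_rotB_end : forall b w, adj b w ->
        rotB (ws_oldB b) (ws_end b w) = ws_end b (rotB b w);
  ws_lface_end : forall b w, adj b w ->
        lface (ws_oldB b) (ws_end b w) = ws_oldF (lface b w)
}.

Variables (D : white_split) (k : fieldType).

Definition white_split_weight (wt : weight k G) (wt' : weight k G') : Prop :=
  [/\ wt' (ws_new D) (ws_oldW D (ws_split D)) = 1,
      wt' (ws_new D) (ws_copy D) = 1
    & forall b w, adj b w -> wt' (ws_oldB D b) (ws_end D b w) = wt b w].

Definition white_split_config (V : lmodType k)
    (c : configuration V G) (c' : configuration V G') : Prop :=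
  [/\ forall w, vec c' (ws_oldW D w) = vec c w,
      vec c' (ws_copy D) = vec c (ws_split D),
      coef c' (ws_new D) (ws_oldW D (ws_split D)) = 1,
      coef c' (ws_new D) (ws_copy D) = -1
    & forall b w, adj b w ->
        coef c' (ws_oldB D b) (ws_end D b w) = coef c b w].

End WhiteSplit.

(* Degree two vertex addition with a new white vertex [bs_new]; same conventions
   with the colours exchanged. *)
Section BlackSplit.
Variables G G' : bimap.

Record black_split := BlackSplit {
  bs_split : black G;
  bs_block1 : seq (white G);
  bs_block2 : seq (white G);
  bs_oldB : black G -> black G';
  bs_oldW : white G -> white G';
  bs_oldF : face G -> face G';
  bs_new : white G';
  bs_copy : black G';
  bs_end := fun (b : black G) (w : white G) =>
    if (b == bs_split) && (w \in bs_block2) then bs_copy else bs_oldB b;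
  bs_blocks_uniq : uniq (bs_block1 ++ bs_block2);
  bs_blocks_adj : bs_block1 ++ bs_block2 =i [pred w | adj bs_split w];
  bs_blocks_clockwise : fcycle (rotB bs_split) (bs_block1 ++ bs_block2);
  bs_black_bij : bijective (oapp bs_oldB bs_copy);
  bs_white_bij : bijective (oapp bs_oldW bs_new);
  bs_face_bij : bijective bs_oldF;
  bs_outer : outer = bs_oldF outer;
  bs_adj_old : forall b w, b != bs_split -> adj (bs_oldB b) (bs_oldW w) = adj b w;
  bs_adj_block1 : forall w, adj (bs_oldB bs_split) (bs_oldW w) = (w \in bs_block1);
  bs_adj_block2 : forall w, adj bs_copy (bs_oldW w) = (w \in bs_block2);
  bs_adj_new : forall b, adj (bs_oldB b) bs_new = (b == bs_split);
  bs_adj_new_copy : adj bs_copy bs_new;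
  bs_rot_block1 : fcycle (rotB (bs_oldB bs_split)) (bs_new :: map bs_oldW bs_block1);
  bs_rot_block2 : fcycle (rotB bs_copy) (bs_new :: map bs_oldW bs_block2);
  bs_rot_new : fcycle (rotW bs_new) [:: bs_oldB bs_split; bs_copy];
  bs_rotB_old : forall b w, adj b w -> b != bs_split ->
        rotB (bs_oldB b) (bs_oldW w) = bs_oldW (rotB b w);
  bs_rotW_end : forall b w, adj b w ->
        rotW (bs_oldW w) (bs_end b w) = bs_end (rotW w b) w;
  bs_lface_end : forall b w, adj b w ->
        lface (bs_end b w) (bs_oldW w) = bs_oldF (lface b w)
}.

Variables (D : black_split) (k : fieldType).

Definition black_split_weight (wt : weight k G) (wt' : weight k G') : Prop :=
  [/\ wt' (bs_oldB D (bs_split D)) (bs_new D) = 1,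
      wt' (bs_copy D) (bs_new D) = 1
    & forall b w, adj b w -> wt' (bs_end D b w) (bs_oldW D w) = wt b w].

Definition black_split_config (V : lmodType k)
    (c : configuration V G) (c' : configuration V G') : Prop :=
  [/\ (forall w, vec c' (bs_oldW D w) = vec c w) /\
      vec c' (bs_new D)
        = \sum_(w <- bs_block1 D) coef c (bs_split D) w *: vec c w,
      coef c' (bs_oldB D (bs_split D)) (bs_new D) = -1,
      coef c' (bs_copy D) (bs_new D) = 1
    & forall b w, adj b w ->
        coef c' (bs_end D b w) (bs_oldW D w) = coef c b w].

End BlackSplit.

Inductive elementary_move (G G' : bimap) :=
| Urban of urban_renewal G G'
| AddBlack of white_split G G'
| AddWhite of black_split G G'.

Inductive local_move (G G' : bimap) :=
| Forward of elementary_move G G'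
| Backward of elementary_move G' G.

Section Moves.
Variables (k : fieldType) (V : lmodType k).

Definition elementary_weight (G G' : bimap) (m : elementary_move G G')
    (wt : weight k G) (wt' : weight k G') : Prop :=
  match m with
  | Urban D => urban_renewal_weight D wt wt'
  | AddBlack D => white_split_weight D wt wt'
  | AddWhite D => black_split_weight D wt wt'
  end.

Definition elementary_config (G G' : bimap) (m : elementary_move G G')
    (c : configuration V G) (c' : configuration V G') : Prop :=
  match m with
  | Urban D => urban_renewal_config D c c'
  | AddBlack D => white_split_config D c c'
  | AddWhite D => black_split_config D c c'
  end.

(* Transformations of gauge classes, given by representatives of the classes. *)
Definition weight_transformed (G G' : bimap) (m : local_move G G')
    (wt : weight k G) (wt' : weight k G') : Prop :=
  exists (wt1 : weight k G) (wt1' : weight k G'),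
    [/\ gauge_weight wt wt1, gauge_weight wt' wt1'
      & match m with
        | Forward e => elementary_weight e wt1 wt1'
        | Backward e => elementary_weight e wt1' wt1
        end].

Definition config_transformed (G G' : bimap) (m : local_move G G')
    (c : configuration V G) (c' : configuration V G') : Prop :=
  exists (c1 : configuration V G) (c1' : configuration V G'),
    [/\ gauge_config c c1, gauge_config c' c1'
      & match m with
        | Forward e => elementary_config e c1 c1'
        | Backward e => elementary_config e c1' c1
        end].

End Moves.

(* Main.v *)
Require Import Defs.
From mathcomp Require Import all_boot all_order all_algebra.
From mathcomp Require Import zify ring.

(* The weights of the two configurations agree with the classical rule up to
   signs, so what has to be shown is that some Kasteleyn signs of G' produce the
   right signs; any other choice is then gauge equivalent.  Signs are transported
   explicitly: in urban renewal the new edge s_j x_i gets the opposite of the sign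
   of b_i w_j and the other new edges get +1; in a degree two vertex addition, the
   new edge with coefficient -1 gets the sign -1.  Over F_2, the Kasteleyn
   condition at a face is a sum of contributions of its edges, and these
   contributions cancel locally.  Uniqueness up to gauge is exactness, by
   Euler's formula, of the complex vertices -> edges -> bounded faces over F_2. *)

Set Implicit Arguments.
Unset Strict Implicit.
Unset Printing Implicit Defensive.

Import GRing.Theory.
Local Open Scope ring_scope.

(** * Rotations that are cyclic on a subset of a finite type *)

Section Rotation.
Variables (T : finType) (r : T -> T) (A : pred T).
Hypothesis rA : forall x, A x -> fconnect r x =i A.

Lemma rot_closed x : A x -> A (r x).
Proof.
by move=> Ax; rewrite -[A _]/(_ \in A) -(rA Ax) inE fconnect1.
Qed.

(** The predecessor of [y] is found by going round the orbit: [r y] lies in [A], so iterating [r]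
    from it returns to [y]. *)
Lemma rot_surj y : A y -> exists2 x, A x & r x = y.
Proof.
move=> Ay; have: y \in fconnect r (r y) by rewrite rA // rot_closed.
move/iter_findex; rewrite -iterSr iterS => ry.
exists (iter (findex r (r y) y) r y) => //.
by rewrite -[A _]/(_ \in A) -(rA Ay) inE fconnect_iter.
Qed.

Lemma rot_imset : r @: A = [set x | A x].
Proof.
apply/setP=> y; rewrite inE; apply/imsetP/idP => [[x Ax ->]|/rot_surj[x Ax <-]].
  exact: rot_closed.
by exists x.
Qed.

(** A map of a finite set onto itself is injective. *)
Lemma rot_inj : {in A &, injective r}.
Proof. by apply/imset_injP; rewrite rot_imset cardsE. Qed.

Lemma rot_sum (R : nmodType) (F : T -> R) :
  \sum_(x | A x) F (r x) = \sum_(x | A x) F x.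
Proof.
rewrite -(big_imset F rot_inj) rot_imset.
by apply: eq_bigl => x; rewrite inE.
Qed.

End Rotation.

Lemma connect_invariant (T : finType) (U : Type) (e : rel T) (f : T -> U) :
  (forall x y, e x y -> f x = f y) -> forall x y, connect e x y -> f x = f y.
Proof.
move=> ef x y /connectP[p ep ->] {y}.
by elim: p x ep => //= y p IHp x /andP[/ef-> /IHp].
Qed.

Lemma sum_eq_op (R : pzSemiRingType) (I : finType) (F : I -> R) (x : I) :
  \sum_i F i * (i == x)%:R = F x.
Proof.
rewrite (bigD1 x) //= eqxx mulr1 big1 ?addr0 // => i /negPf->.
by rewrite mulr0.
Qed.

(** * Exactness over a field by counting ranks *)

Section Exactness.
Variable F : fieldType.

(** Appending the columns of [S] to [A] makes the left kernel trivial, and [p] columns raise the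
    rank by at most [p]. *)
Lemma row_free_rank m n p (A : 'M[F]_(m, n)) (S : 'M[F]_(m, p)) :
  (forall u : 'rV_m, u *m A = 0 -> u *m S = 0 -> u = 0) -> (m <= \rank A + p)%N.
Proof.
move=> AS0; have free_AS: row_free (row_mx A S).
  rewrite -kermx_eq0; apply/eqP/row_matrixP=> i; rewrite row0.
  have: row i (kermx (row_mx A S)) *m row_mx A S = 0.
    by rewrite -row_mul mulmx_ker row0.
  rewrite mul_mx_row -[0 in RHS]row_mx0 => /eq_row_mx[uA uS].
  exact: AS0.
rewrite -{1}(eqP free_AS) -mxrank_tr tr_row_mx -addsmxE.
rewrite (leq_trans (mxrank_adds_leqif _ _)) // mxrank_tr leq_add2l.
exact: rank_leq_row.
Qed.

(** The row space of [A] lies in the kernel of [B], which has dimension [n - \rank B]; the bound on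
    ranks makes the two equal. *)
Lemma exact_by_rank m n p (A : 'M[F]_(m, n)) (B : 'M[F]_(n, p)) :
  A *m B = 0 -> (n <= \rank A + \rank B)%N ->
  forall v : 'rV_n, v *m B = 0 -> exists u : 'rV_m, v = u *m A.
Proof.
move=> AB0 rAB v vB0; apply/submxP.
apply: (submx_trans (B := kermx B)); first exact/sub_kermxP.
have /mxrank_leqif_sup leAB: (A <= kermx B)%MS by apply/sub_kermxP.
by rewrite -(geq_leqif leAB) mxrank_ker leq_subLR addnC.
Qed.

End Exactness.

(** * Kasteleyn conditions over F_2 on a planar bipartite graph *)

Section Planar.
Variable G : bimap.
Implicit Types (b : black G) (w : white G) (f : face G).
Implicit Types eps : black G -> white G -> bool.

Lemma sum_edges (R : nmodType) (F : black G -> white G -> R) :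
  \sum_(e in edges G) F e.1 e.2 = \sum_b \sum_(w | adj b w) F b w.
Proof.
by rewrite pair_big_dep /=; apply: eq_bigl => e; rewrite inE.
Qed.

Lemma card_edges (P : black G -> white G -> bool) :
  #|[set e in edges G | P e.1 e.2]| = (\sum_b \sum_(w | adj b w) P b w)%N.
Proof.
rewrite -(@sum_edges nat (fun b w => nat_of_bool (P b w))) -sum1_card.
rewrite (eq_bigl (fun e => (e \in edges G) && P e.1 e.2)) => [|e]; last first.
  by rewrite inE.
by rewrite big_mkcondr; apply: eq_bigr => e _; case: (P _ _).
Qed.

Lemma odd_card_edges (P : black G -> white G -> bool) :
  odd #|[set e in edges G | P e.1 e.2]| = \sum_b \sum_(w | adj b w) P b w.
Proof.
rewrite card_edges (big_morph _ oddD (erefl (odd 0))); apply: eq_bigr => b _.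
by rewrite (big_morph _ oddD (erefl (odd 0))); apply: eq_bigr => w _; rewrite oddb.
Qed.

(* The parity of half the degree of [f] plus the number of its minus signs: each
   edge contributes [1 + eps] to the face on its left and [eps] to the face on its
   right, because exactly half of the sides of a face have it on their left. *)
Definition face_sum eps f : bool :=
  \sum_b \sum_(w | adj b w)
     (((lface b w == f) && ~~ eps b w : bool)
      + ((rface b w == f) && eps b w : bool)).

Hypothesis PG : planar G.

Lemma adj_rotB b w : adj b w -> adj b (rotB b w).
Proof. exact: (rot_closed (A := adj b) (@rotB_cyclic _ PG b)). Qed.

Lemma rotW_surj b w : adj b w -> exists2 b0, adj b0 w & rotW w b0 = b.
Proof.
exact: (rot_surj (A := fun b => adj b w) (fun b => @rotW_cyclic _ PG b w)).
Qed.

Lemma rotB_inj b w w' : adj b w -> adj b w' -> rotB b w = rotB b w' -> w = w'.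
Proof. exact: (rot_inj (A := adj b) (@rotB_cyclic _ PG b)). Qed.

Lemma sum_face_black (R : nmodType) (F : face G -> R) b :
  \sum_(w | adj b w) F (rface b w) = \sum_(w | adj b w) F (lface b w).
Proof.
exact: (rot_sum (A := adj b) (@rotB_cyclic _ PG b) (fun w => F (lface b w))).
Qed.

(** By [face_walk], the right face of the next edge around [w] is the left face of the current one,
    so the two sums differ by a rotation. *)
Lemma sum_face_white (R : nmodType) (F : face G -> R) w :
  \sum_(b | adj b w) F (rface b w) = \sum_(b | adj b w) F (lface b w).
Proof.
rewrite -(rot_sum (A := fun b => adj b w) (fun b => @rotW_cyclic _ PG b w)
  (fun b => F (rface b w))).
by apply: eq_bigr => b /(face_walk PG)->.
Qed.

(** Rotating around each black vertex matches the right sides of [f] with its left sides. *)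
Lemma degree_left f :
  degree f = (2 * #|[set e in edges G | lface e.1 e.2 == f]|)%N.
Proof.
rewrite /degree !(card_edges (fun b w => _ b w == f)).
suff ->: (\sum_b \sum_(w | adj b w) (rface b w == f))%N
    = (\sum_b \sum_(w | adj b w) (lface b w == f))%N by lia.
apply: eq_bigr => b _.
exact: (@sum_face_black nat (fun f' => nat_of_bool (f' == f))).
Qed.

Lemma face_sumE eps f :
  face_sum eps f = odd #|[set e in edges G | lface e.1 e.2 == f]|
                   (+) odd (minus_signs eps f).
Proof.
rewrite /minus_signs oddD (odd_card_edges (fun b w => lface b w == f)).
rewrite (odd_card_edges (fun b w => (lface b w == f) && eps b w)).
rewrite (odd_card_edges (fun b w => (rface b w == f) && eps b w)).
rewrite -!(big_split addb) /=; apply: eq_bigr => b _.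
rewrite -!(big_split addb) /=; apply: eq_bigr => w _.
by case: (_ == f); case: (_ == f); case: (eps b w).
Qed.

(** As the degree is [2n], the cases 0 and 2 modulo 4 are [n] even and [n] odd. In both, the
    condition says that [n] plus the number of minus signs is odd. *)
Lemma kasteleynP eps :
  kasteleyn eps <-> forall f, f != outer -> face_sum eps f.
Proof.
split=> kast f /[dup] f_bounded /kast; rewrite face_sumE degree_left.
  set n := #|_|; case=> k0 k2.
  case odd_n: (odd n); first by apply: k2; lia.
  by apply: k0; lia.
by set n := #|_|; case odd_n: (odd n) => /= ks; split=> // ?; lia.
Qed.

(** The map from edges to faces in the F_2 complex, with [bool] as the field; an edge with the same
    face on both sides contributes nothing. *)
Definition joint_sum (F : black G -> white G -> bool) f : bool :=
  \sum_b \sum_(w | adj b w)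
     ((lface b w == f : bool) + (rface b w == f : bool)) * F b w.

(** [face_sum] is affine in the signs with linear part [joint_sum]; the constant terms cancel modulo
    2. *)
Lemma joint_sum_face_sum eps eps' f :
  joint_sum (fun b w => eps b w + eps' b w) f = face_sum eps f + face_sum eps' f.
Proof.
rewrite -big_split; apply: eq_bigr => b _ /=.
rewrite -big_split; apply: eq_bigr => w _ /=.
by case: (_ == f); case: (_ == f); case: (eps b w); case: (eps' b w).
Qed.

(** Around any vertex, [f] occurs as often on the left as on the right, so each vertex value is
    counted an even number of times. *)
Lemma joint_sum_coboundary (g : black G -> bool) (h : white G -> bool) f :
  joint_sum (fun b w => g b + h w) f = 0.
Proof.
pose sides b w : bool := (lface b w == f : bool) + (rface b w == f : bool).
transitivity (\sum_b \sum_(w | adj b w) sides b w * g b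
  + \sum_w \sum_(b | adj b w) sides b w * h w : bool).
  rewrite [X in _ = _ + X](exchange_big_dep xpredT) //= -big_split.
  apply: eq_bigr => b _ /=; rewrite -big_split.
  by apply: eq_bigr => w _; rewrite mulrDr.
rewrite !big1 ?addr0 // => [w|b] _; rewrite -mulr_suml big_split /=.
  by rewrite (sum_face_white (fun f' => f' == f)); case: (\sum_(_ | _) _).
by rewrite (sum_face_black (fun f' => f' == f)); case: (\sum_(_ | _) _).
Qed.

Lemma vertex_rel_sym : symmetric (@vertex_rel G).
Proof. by move=> [b|w] [b'|w']. Qed.

(* The coboundary map has rank at least [V - C], the boundary map of the bounded
   faces has rank at least [F - 1], and by Euler's formula these add up to [E]:
   the planar case of exactness at the edges. *)
Lemma coboundary_of_joint_sum (F : black G -> white G -> bool) :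
  (forall f, f != outer -> joint_sum F f = 0) ->
  exists (g : black G -> bool) (h : white G -> bool),
    forall b w, adj b w -> F b w = g b + h w.
Proof.
move=> F0.
pose vert : finType := (black G + white G)%type.
pose edge (i : 'I_#|edges G|) := enum_val i.
pose A : 'M[bool]_(#|vert|, #|edges G|) := \matrix_(v, i)
  ((v == enum_rank (inl (edge i).1 : vert))%:R
   + (v == enum_rank (inr (edge i).2 : vert))%:R).
(* The first factor zeroes the column of [outer], so that only bounded faces impose a condition. *)
pose B : 'M[bool]_(#|edges G|, #|face G|) := \matrix_(i, j)
  ((enum_val j != outer : bool) *
   ((lface (edge i).1 (edge i).2 == enum_val j : bool)
    + (rface (edge i).1 (edge i).2 == enum_val j : bool))).
have sum_edge (H : black G -> white G -> bool) :
    \sum_i H (edge i).1 (edge i).2 = \sum_b \sum_(w | adj b w) H b w.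
  by rewrite -sum_edges [RHS]big_enum_val.
have edge_rank b w : adj b w -> exists i, edge i = (b, w).
  move=> bw; have ebw: (b, w) \in edges G by rewrite inE.
  by exists (enum_rank_in ebw (b, w)); rewrite /edge enum_rankK_in.
have uA (u : 'rV_#|vert|) i : (u *m A) 0 i
    = u 0 (enum_rank (inl (edge i).1 : vert)) + u 0 (enum_rank (inr (edge i).2 : vert)).
  rewrite mxE; under eq_bigr do rewrite mxE mulrDr.
  by rewrite big_split /= !sum_eq_op.
have vB (H : black G -> white G -> bool) j :
    ((\row_i H (edge i).1 (edge i).2) *m B) 0 j
      = (enum_val j != outer : bool) * joint_sum H (enum_val j).
  rewrite mxE mulr_sumr; under [RHS]eq_bigr do rewrite mulr_sumr.
  rewrite -sum_edge; apply: eq_bigr => i _; rewrite !mxE.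
  by rewrite mulrC mulrA.
(* Row [v] of [A] is the coboundary of the indicator function of the vertex [v]. *)
have AB0: A *m B = 0.
  apply/row_matrixP=> v; rewrite row_mul row0; apply/rowP=> j; rewrite [RHS]mxE.
  rewrite -[RHS](mulr0 (enum_val j != outer : bool)).
  rewrite -(joint_sum_coboundary (fun b => v == enum_rank (inl b : vert))
    (fun w => v == enum_rank (inr w : vert)) (enum_val j)) -vB.
  congr ((_ *m B) 0 j); apply/rowP=> i; rewrite !mxE.
  by do 2!case: (v == _).
have rankA: (#|vert| <= \rank A + n_comp (@vertex_rel G) predT)%N.
  (* One column per component, reading the value at its root: a vector killed by [A] is constant on
     components. *)
  pose reps : pred vert := predI (roots (@vertex_rel G)) predT.
  pose S : 'M[bool]_(#|vert|, #|reps|) :=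
    \matrix_(v, r) (v == enum_rank (enum_val r))%:R.
  apply: (row_free_rank (S := S)) => u u0 uS; apply/rowP=> v; rewrite mxE.
  have ru x y : vertex_rel x y -> u 0 (enum_rank x) = u 0 (enum_rank y).
    have adj_u b w : adj b w ->
        u 0 (enum_rank (inl b : vert)) = u 0 (enum_rank (inr w : vert)).
      move=> /edge_rank[i ei]; have := uA u i; rewrite u0 mxE ei /=.
      by do 2!case: (u 0 _).
    by case: x y => [b|w] [b'|w'] //= /adj_u ->.
  rewrite -[v]enum_valK.
  rewrite (connect_invariant ru (connect_root (@vertex_rel G) (enum_val v))).
  have rep_v: fingraph.root (@vertex_rel G) (enum_val v) \in reps.
    by rewrite inE /= andbT roots_root //; apply/sym_connect_sym/vertex_rel_sym.
  have := congr1 (fun M : 'rV_#|reps| => M 0 (enum_rank_in rep_v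
    (fingraph.root (@vertex_rel G) (enum_val v)))) uS.
  rewrite !mxE; under eq_bigr do rewrite mxE.
  by rewrite sum_eq_op enum_rankK_in.
have rankB: (#|face G| <= \rank B + 1)%N.
  (* The single column reads the value at [outer]. Once this is zero, a vector killed by [B^T] is
     constant along [dual_rel], hence zero. *)
  pose S : 'M[bool]_(#|face G|, 1) := \matrix_(j, _) (j == enum_rank outer)%:R.
  rewrite -mxrank_tr; apply: (row_free_rank (S := S)) => u u0 uS.
  have u_outer: u 0 (enum_rank outer) = 0.
    have := congr1 (fun M : 'rV_1 => M 0 0) uS; rewrite !mxE.
    by under eq_bigr do rewrite mxE; rewrite sum_eq_op.
  apply/rowP=> j; rewrite mxE -u_outer -[j]enum_valK.
  have du f f' : dual_rel f f' -> u 0 (enum_rank f) = u 0 (enum_rank f').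
    case/existsP=> -[b w] /andP[] /=; rewrite inE /= => /edge_rank[i ei].
    suff lr: u 0 (enum_rank (lface b w)) = u 0 (enum_rank (rface b w)).
      by case/orP=> /andP[/eqP<- /eqP<-].
    have: (u *m B^T) 0 i = 0 by rewrite u0 mxE.
    rewrite mxE.
    under eq_bigr => j' _.
      rewrite !mxE ei /=.
      have ->: u 0 j' * ((enum_val j' != outer : bool)
            * ((lface b w == enum_val j' : bool) + (rface b w == enum_val j' : bool)))
          = u 0 j' * (j' == enum_rank (lface b w))%:R
            + u 0 j' * (j' == enum_rank (rface b w))%:R.
        have enum_rank_eq f0 : (j' == enum_rank f0) = (f0 == enum_val j').
          by rewrite -(can_eq enum_valK) enum_rankK eq_sym.
        rewrite !enum_rank_eq.
        have [j'_outer|_] := eqVneq (enum_val j') outer.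
          have ->: u 0 j' = 0 by rewrite -[j']enum_valK j'_outer.
          by rewrite !mul0r.
        by rewrite mul1r mulrDr; do 2!case: (_ == enum_val j').
      over.
    rewrite big_split /= !sum_eq_op.
    by do 2!case: (u 0 _).
  exact: (connect_invariant du (dual_connected PG _ _)).
have rankAB: (#|edges G| <= \rank A + \rank B)%N.
  have := euler_formula PG; have: #|vert| = (#|black G| + #|white G|)%N.
    exact: card_sum.
  lia.
have [|u def_u] := exact_by_rank AB0 rankAB (v := \row_i F (edge i).1 (edge i).2).
  apply/rowP=> j; rewrite vB mxE.
  by have [->|/F0->] := eqVneq (enum_val j) outer; rewrite ?mulr0 // mul0r.
exists (fun b => u 0 (enum_rank (inl b : vert))).
exists (fun w => u 0 (enum_rank (inr w : vert))) => b w /edge_rank[i ei].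
have := congr1 (fun M : 'rV_#|edges G| => M 0 i) def_u.
by rewrite mxE uA ei.
Qed.

Lemma kasteleyn_unique eps eps' : kasteleyn eps -> kasteleyn eps' ->
  exists (g : black G -> bool) (h : white G -> bool),
    forall b w, adj b w -> eps' b w = eps b w (+) (g b (+) h w).
Proof.
move=> /kasteleynP ke /kasteleynP ke'.
have [|g [h gh]] := @coboundary_of_joint_sum (fun b w => eps b w + eps' b w).
  by move=> f fb; rewrite joint_sum_face_sum ke // ke'.
exists g, h => b w /gh.
by case: (eps b w); case: (eps' b w); case: (g b); case: (h w).
Qed.

End Planar.

(** * Gauge equivalence of weights and independence of the choice of signs *)

Section Gauge.
Variables (k : fieldType) (G : bimap).
Implicit Types wt : weight k G.

Lemma gauge_weight_sym wt wt' : gauge_weight wt wt' -> gauge_weight wt' wt.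
Proof.
case=> g [h [g0 h0 def_wt']].
exists (fun b => (g b)^-1), (fun w => (h w)^-1).
split=> [b|w|b w /def_wt'->]; rewrite ?invr_neq0 //.
by rewrite -invfM mulKf // mulf_neq0.
Qed.

Lemma gauge_weight_trans wt1 wt2 wt3 :
  gauge_weight wt1 wt2 -> gauge_weight wt2 wt3 -> gauge_weight wt1 wt3.
Proof.
move=> [g [h [g0 h0 def2]]] [g' [h' [g'0 h'0 def3]]].
exists (fun b => g' b * g b), (fun w => h' w * h w).
split=> [b|w|b w bw]; rewrite ?mulf_neq0 //.
by rewrite def3 // def2 // mulrA [g' b * _ * _]mulrACA.
Qed.

Definition signed_weight (eps : black G -> white G -> bool) (K : weight k G) :
    weight k G :=
  fun b w => (-1) ^+ eps b w * K b w.

Lemma kasteleyn_gauge eps eps' (K : weight k G) :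
  planar G -> kasteleyn eps -> kasteleyn eps' ->
  gauge_weight (signed_weight eps K) (signed_weight eps' K).
Proof.
move=> PG ke ke'; have [g [h def_eps']] := kasteleyn_unique PG ke ke'.
exists (fun b => (-1) ^+ g b), (fun w => (-1) ^+ h w).
split=> [b|w|b w /def_eps' E]; rewrite ?signr_eq0 //.
by rewrite /signed_weight E !signr_addb -mulrA mulrCA.
Qed.

Lemma gauge_config_weight (V : lmodType k) (c c' : configuration V G) eps :
  gauge_config c c' ->
  gauge_weight (signed_weight eps (coef c)) (signed_weight eps (coef c')).
Proof.
case=> g [h [g0 h0 _ def_c']]; exists g, h; split=> // b w _.
by rewrite /signed_weight def_c' mulrCA.
Qed.

(** Allows signs and representative to be chosen freely: a change of Kasteleyn signs is a gauge
    transformation, and a gauge of the configuration acts on its coefficients as on weights. *)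
Lemma associated_weight_kasteleyn (V : lmodType k) (c c' : configuration V G)
    wt eps :
  planar G -> gauge_config c c' -> associated_weight c wt -> kasteleyn eps ->
  gauge_weight wt (signed_weight eps (coef c')).
Proof.
move=> PG cc' [eps0 k0 /gauge_weight_sym wt0] ke.
apply: gauge_weight_trans (gauge_config_weight eps cc').
exact: gauge_weight_trans wt0 (kasteleyn_gauge (coef c) PG k0 ke).
Qed.

End Gauge.

(** Bounded faces correspond because [oldF] is bijective and preserves [outer]; each move is thereby
    reduced to comparing [face_sum] on matching faces. *)
Lemma kasteleyn_transport (G G' : bimap) (oldF : face G -> face G') eps eps' :
  planar G -> planar G' -> bijective oldF -> outer = oldF outer ->
  (forall f, face_sum eps' (oldF f) = face_sum eps f) ->
  kasteleyn eps -> kasteleyn eps'.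
Proof.
move=> PG PG' [newF oldFK newFK] outerE eq_sum /(kasteleynP PG) ke.
apply/(kasteleynP PG') => f; rewrite -[f]newFK outerE (can_eq oldFK) eq_sum.
exact: ke.
Qed.

Lemma sum_option (R : nmodType) (I : finType) (F : option I -> R) :
  \sum_x F x = \sum_i F (Some i) + F None.
Proof.
rewrite (bigD1 None) //= addrC (reindex_omap Some id) => [|[]//].
by congr (_ + _); apply: eq_bigl => i; rewrite eqxx.
Qed.

Lemma sum_codom (R : nmodType) (I J : finType) (h : I -> J) (F : J -> R) :
  injective h -> \sum_(j in codom h) F j = \sum_i F (h i).
Proof.
move=> h_inj; rewrite -(big_imset (A := predT) F (in2W h_inj)).
by apply: eq_bigl => j; apply/codomP/imsetP=> [[i ->]|[i _ ->]]; exists i.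
Qed.

(** * Splitting a white vertex *)

Section WhiteSplit.
Variables (G G' : bimap) (D : white_split G G').
Local Notation split := (ws_split D).
Local Notation oldB := (ws_oldB D).
Local Notation oldW := (ws_oldW D).
Local Notation new := (ws_new D).
Local Notation copy := (ws_copy D).
Local Notation ws_end := (ws_end D).

(** The two blocks are disjoint and cover the neighbours of the split vertex, so each edge there
    survives at exactly one copy, the one given by [ws_end]. *)
Lemma white_split_sum (R : nmodType) (T : black G' -> white G' -> R) :
  \sum_b \sum_(w | adj b w) T b w =
  \sum_b \sum_(w | adj b w) T (oldB b) (ws_end b w) + (T new (oldW split) + T new copy).
Proof.
rewrite (reindex _ (onW_bij _ (ws_black_bij D))) sum_option /=; congr (_ + _).
  apply: eq_bigr => b _.
  rewrite big_mkcond (reindex _ (onW_bij _ (ws_white_bij D))) sum_option /=.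
  rewrite [RHS]big_mkcond (bigD1 split) //= [RHS](bigD1 split) //= addrAC.
  congr (_ + _); last first.
    apply: eq_bigr => w w_split; rewrite ws_adj_old //.
    by rewrite /Defs.ws_end (negPf w_split).
  have := ws_blocks_adj D b; rewrite mem_cat inE => <-.
  rewrite ws_adj_block1 ws_adj_block2 /Defs.ws_end eqxx /=.
  have := ws_blocks_uniq D; rewrite cat_uniq => /and3P[_ /hasPn/(_ b) + _].
  case: (b \in ws_block2 D) => [/(_ isT)/= /negPf->|_]; first by rewrite add0r.
  by rewrite orbF addr0.
rewrite big_mkcond (reindex _ (onW_bij _ (ws_white_bij D))) sum_option /=.
rewrite ws_adj_new_copy; congr (_ + _); rewrite (bigD1 split) //= ws_adj_new eqxx.
by rewrite big1 ?addr0 // => w /negPf; rewrite ws_adj_new => ->.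
Qed.

Hypotheses (PG : planar G) (PG' : planar G').

Lemma white_split_rface b w : adj b w ->
  rface (oldB b) (ws_end b w) = ws_oldF D (rface b w).
Proof. by move=> bw; rewrite /rface ws_rotB_end // ws_lface_end // adj_rotB. Qed.

(** The new edge with sign +1 contributes only to its left face, the one with sign -1 only to its
    right face. Rotating around [new] shows that these faces coincide, so the contributions
    cancel. *)
Lemma white_split_kasteleyn eps : kasteleyn eps ->
  exists2 eps', kasteleyn eps' &
    [/\ forall b w, adj b w -> eps' (oldB b) (ws_end b w) = eps b w,
        eps' new (oldW split) = false & eps' new copy = true].
Proof.
move=> ke; have [newB oldBK newBK] := ws_black_bij D.
have [newW oldWK newWK] := ws_white_bij D.
(* [copy] inherits the signs of the vertex it was split from; the two cases with [newB b' = None]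
   are the new edges. *)
pose eps' b' w' :=
  match newB b', newW w' with
  | Some b, Some w => eps b w
  | Some b, None => eps b split
  | None, Some _ => false
  | None, None => true
  end.
have newB_old b : newB (oldB b) = Some b := oldBK (Some b).
have newB_new : newB new = None := oldBK None.
have newW_old w : newW (oldW w) = Some w := oldWK (Some w).
have newW_copy : newW copy = None := oldWK None.
have eps'_end b w : eps' (oldB b) (ws_end b w) = eps b w.
  rewrite /eps' /Defs.ws_end newB_old; case: ifP => [/andP[/eqP-> _]|_].
    by rewrite newW_copy.
  by rewrite newW_old.
have eps'_old : eps' new (oldW split) = false by rewrite /eps' newB_new newW_old.
have eps'_copy : eps' new copy = true by rewrite /eps' newB_new newW_copy.
exists eps'; last by split.
apply: (kasteleyn_transport PG PG' (ws_face_bij D) (ws_outer D)) ke => f.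
have [newF oldFK _] := ws_face_bij D.
rewrite /face_sum white_split_sum eps'_old eps'_copy /rface.
have /and3P[/eqP-> /eqP-> _] := ws_rot_new D.
rewrite [X in _ + X](_ : _ = 0) ?addr0; last by do 2!case: (_ == _).
apply: eq_bigr => b _; apply: eq_bigr => w bw; rewrite eps'_end.
by rewrite ws_lface_end // -/(rface _ _) white_split_rface // !(can_eq oldFK).
Qed.

End WhiteSplit.

(** * Splitting a black vertex *)

Section BlackSplit.
Variables (G G' : bimap) (D : black_split G G').
Local Notation split := (bs_split D).
Local Notation oldB := (bs_oldB D).
Local Notation oldW := (bs_oldW D).
Local Notation new := (bs_new D).
Local Notation copy := (bs_copy D).
Local Notation bs_end := (bs_end D).

Lemma black_split_adj_end b w : adj b w -> adj (bs_end b w) (oldW w).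
Proof.
rewrite /Defs.bs_end; have [->|b_split] := eqVneq b split; last by rewrite bs_adj_old.
have := bs_blocks_adj D w; rewrite mem_cat inE => <-.
case w2: (w \in bs_block2 D); first by rewrite bs_adj_block2.
by rewrite orbF bs_adj_block1.
Qed.

Lemma black_split_sum (R : nmodType) (T : black G' -> white G' -> R) :
  \sum_b \sum_(w | adj b w) T b w =
  \sum_b \sum_(w | adj b w) T (bs_end b w) (oldW w) + (T (oldB split) new + T copy new).
Proof.
rewrite (exchange_big_dep xpredT) //= [X in _ = X + _](exchange_big_dep xpredT) //=.
rewrite (reindex _ (onW_bij _ (bs_white_bij D))) sum_option /=; congr (_ + _).
  apply: eq_bigr => w _.
  rewrite big_mkcond (reindex _ (onW_bij _ (bs_black_bij D))) sum_option /=.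
  rewrite [RHS]big_mkcond (bigD1 split) //= [RHS](bigD1 split) //= addrAC.
  congr (_ + _); last first.
    apply: eq_bigr => b b_split; rewrite bs_adj_old //.
    by rewrite /Defs.bs_end (negPf b_split).
  have := bs_blocks_adj D w; rewrite mem_cat inE => <-.
  rewrite bs_adj_block1 bs_adj_block2 /Defs.bs_end eqxx /=.
  have := bs_blocks_uniq D; rewrite cat_uniq => /and3P[_ /hasPn/(_ w) + _].
  case: (w \in bs_block2 D) => [/(_ isT)/= /negPf->|_]; first by rewrite add0r.
  by rewrite orbF addr0.
rewrite big_mkcond (reindex _ (onW_bij _ (bs_black_bij D))) sum_option /=.
rewrite bs_adj_new_copy; congr (_ + _); rewrite (bigD1 split) //= bs_adj_new eqxx.
by rewrite big1 ?addr0 // => b /negPf; rewrite bs_adj_new => ->.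
Qed.

Hypotheses (PG : planar G) (PG' : planar G').

(** [rface] is defined by rotation around the black end, but [bs_end] is compatible with rotation
    around the white one; [face_walk] rewrites the right face as the left face of the preceding edge
    around [w]. *)
Lemma black_split_rface b w : adj b w ->
  rface (bs_end b w) (oldW w) = bs_oldF D (rface b w).
Proof.
move=> /(rotW_surj PG)[b0 b0w <-]; rewrite -bs_rotW_end // (face_walk PG') //.
  by rewrite (face_walk PG) // bs_lface_end.
exact: black_split_adj_end.
Qed.

Lemma black_split_kasteleyn eps : kasteleyn eps ->
  exists2 eps', kasteleyn eps' &
    [/\ forall b w, adj b w -> eps' (bs_end b w) (oldW w) = eps b w,
        eps' (oldB split) new = true & eps' copy new = false].
Proof.
move=> ke; have [newB oldBK newBK] := bs_black_bij D.
have [newW oldWK newWK] := bs_white_bij D.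
pose eps' b' w' :=
  match newB b', newW w' with
  | Some b, Some w => eps b w
  | None, Some w => eps split w
  | Some _, None => true
  | None, None => false
  end.
have newB_old b : newB (oldB b) = Some b := oldBK (Some b).
have newB_copy : newB copy = None := oldBK None.
have newW_old w : newW (oldW w) = Some w := oldWK (Some w).
have newW_new : newW new = None := oldWK None.
have eps'_end b w : eps' (bs_end b w) (oldW w) = eps b w.
  rewrite /eps' /Defs.bs_end newW_old; case: ifP => [/andP[/eqP-> _]|_].
    by rewrite newB_copy.
  by rewrite newB_old.
have eps'_old : eps' (oldB split) new = true by rewrite /eps' newB_old newW_new.
have eps'_copy : eps' copy new = false by rewrite /eps' newB_copy newW_new.
exists eps'; last by split.
apply: (kasteleyn_transport PG PG' (bs_face_bij D) (bs_outer D)) ke => f.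
have [newF oldFK _] := bs_face_bij D.
rewrite /face_sum black_split_sum eps'_old eps'_copy.
(* The same cancellation as for a white split, except that the common face is found by [face_walk]
   around [new]. *)
have rface_old : rface (oldB split) new = lface copy new.
  have /and3P[_ /eqP rot_copy _] := bs_rot_new D.
  by rewrite -rot_copy (face_walk PG') ?bs_adj_new_copy.
rewrite rface_old [X in _ + X](_ : _ = 0) ?addr0; last by do 3!case: (_ == _).
apply: eq_bigr => b _; apply: eq_bigr => w bw; rewrite eps'_end.
by rewrite bs_lface_end // black_split_rface // !(can_eq oldFK).
Qed.

End BlackSplit.

(** * Two-element indices and the inverse of a signed 2 by 2 matrix *)

Lemma ord2_ind (P : 'I_2 -> Prop) : P ord0 -> P ord_max -> forall i, P i.
Proof.
move=> P0 P1 [[|[|//]] lti].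
  by rewrite (_ : Ordinal lti = ord0) //; apply: val_inj.
by rewrite (_ : Ordinal lti = ord_max) //; apply: val_inj.
Qed.

Lemma rev_ord2 : rev_ord (ord0 : 'I_2) = ord_max /\ rev_ord (ord_max : 'I_2) = ord0.
Proof. by split; apply: val_inj. Qed.

Lemma rev_ord2_neq (i : 'I_2) : (rev_ord i == i) = false.
Proof. by elim/ord2_ind: i. Qed.

Lemma neq_rev_ord2 (i j : 'I_2) : j != i -> j = rev_ord i.
Proof. by elim/ord2_ind: i; elim/ord2_ind: j => // _; apply: val_inj. Qed.

Lemma sum_ord2 (R : nmodType) (i : 'I_2) (F : 'I_2 -> R) :
  \sum_j F j = F i + F (rev_ord i).
Proof.
rewrite (bigD1 i) //= (big_pred1 (rev_ord i)) // => j.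
by apply/idP/eqP=> [/neq_rev_ord2|->]; rewrite // rev_ord2_neq.
Qed.

(** An odd number of minus signs turns the determinant into [Delta] up to sign. The negated sign on
    the left absorbs the minus that comes from moving the [u_j] terms across the relation. *)
Lemma inverse_signed_mx2 (k : fieldType) (M : 'M[k]_2) (e : 'I_2 -> 'I_2 -> bool) :
  M \in unitmx -> M ord0 ord0 != 0 ->
  e ord0 ord0 (+) e ord0 ord_max (+) e ord_max ord0 (+) e ord_max ord_max ->
  let W i j := (-1) ^+ e i j * M i j in
  let Delta := W ord0 ord0 * W ord_max ord_max + W ord_max ord0 * W ord0 ord_max in
  Delta != 0 /\
  forall i j, (-1) ^+ (~~ e j i) * - invmx M i j = W (rev_ord j) (rev_ord i) / Delta.
Proof.
move=> unitM M00 odd_e W Delta; have [rev0 rev1] := rev_ord2.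
(* Up to one global sign, [N] is the adjugate of [M]. *)
pose N : 'M[k]_2 := \matrix_(i, j) ((-1) ^+ e j i * W (rev_ord j) (rev_ord i)).
have MN : M *m N = Delta%:M.
  apply/matrixP=> i l; rewrite !mxE (sum_ord2 ord0) !mxE rev0 rev1 /Delta /W.
  move: odd_e; elim/ord2_ind: i; elim/ord2_ind: l; rewrite ?rev0 ?rev1 /=;
  case: (e ord0 ord0); case: (e ord0 ord_max); case: (e ord_max ord0);
  by case: (e ord_max ord_max) => //= _; rewrite ?expr0 ?expr1; ring.
have def_N : N = Delta *: invmx M.
  by rewrite -[N](mulKmx unitM) MN mul_mx_scalar.
have Delta0 : Delta != 0.
  (* If [Delta] were zero, so would be [N], whose last diagonal entry is [M ord0 ord0] up to
     sign. *)
  apply: contraNneq M00 => Delta0.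
  have := congr1 (fun A : 'M_2 => A ord_max ord_max) def_N.
  rewrite Delta0 scale0r !mxE rev1 => /eqP.
  by rewrite !mulf_eq0 !signr_eq0.
split=> // i j; have := congr1 (fun A : 'M_2 => A i j) def_N.
rewrite !mxE; move: (W _ _) => w def_w; apply: (canRL (mulfK Delta0)).
transitivity ((-1) ^+ e j i * (Delta * invmx M i j)); last by rewrite -def_w signrMK.
by case: (e j i) => /=; rewrite ?expr0 ?expr1; ring.
Qed.

(** * Urban renewal *)

Section UrbanRenewal.
Variables (G G' : bimap) (D : urban_renewal G G').
Local Notation bF := (ur_b D).
Local Notation wF := (ur_w D).
Local Notation F := (ur_F D).
Local Notation oldB := (ur_oldB D).
Local Notation oldW := (ur_oldW D).
Local Notation oldF := (ur_oldF D).
Local Notation s := (ur_s D).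
Local Notation x := (ur_x D).
Local Notation quad := (quad_edge bF wF).

(** Each index [i] pairs the two sides of [F] at [wF i]: the first has [F] on its left, the second
    on its right. *)
Lemma urban_sum_old (R : nmodType) (T : black G -> white G -> R) :
  \sum_b \sum_(w | adj b w) T b w =
  \sum_b \sum_(w | adj b w && ~~ quad b w) T b w
  + \sum_i (T (bF i) (wF i) + T (bF (rev_ord i)) (wF i)).
Proof.
have -> : \sum_i (T (bF i) (wF i) + T (bF (rev_ord i)) (wF i))
    = \sum_b \sum_(w | adj b w && quad b w) T b w.
  transitivity (\sum_(b in codom bF) \sum_(w in codom wF) T b w).
    rewrite (sum_codom _ (@ur_b_inj _ _ D)) exchange_big (sum_codom _ (@ur_w_inj _ _ D)).
    by apply: eq_bigr => i _; rewrite (sum_ord2 i).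
  rewrite [LHS]big_mkcond; apply: eq_bigr => b _; case: ifP => b_quad.
    apply: eq_bigl => w; rewrite /quad_edge b_quad /=; case: (boolP (w \in _)).
      by case/codomP: b_quad => i -> /codomP[j ->]; rewrite ur_adj_bw.
    by rewrite andbF.
  by rewrite big_pred0 // => w; rewrite /quad_edge b_quad andbF.
rewrite -big_split; apply: eq_bigr => b _ /=.
by rewrite (bigID (quad b)) addrC.
Qed.

Lemma urban_sum_new (R : nmodType) (T : black G' -> white G' -> R) :
  \sum_b \sum_(w | adj b w) T b w =
  \sum_b \sum_(w | adj b w && ~~ quad b w) T (oldB b) (oldW w)
  + \sum_i (T (oldB (bF i)) (x i) + T (s i) (oldW (wF i))
            + (T (s i) (x i) + T (s i) (x (rev_ord i)))).
Proof.
have sumW b' : \sum_(w | adj b' w) T b' w = \sum_(w | adj b' (oldW w)) T b' (oldW w)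
    + \sum_(i | adj b' (x i)) T b' (x i).
  by rewrite (reindex _ (onW_bij _ (ur_white_bij D))) big_sumType.
rewrite (reindex _ (onW_bij _ (ur_black_bij D))) big_sumType /=.
rewrite !big_split /= -!addrA; under eq_bigr do rewrite sumW.
rewrite big_split /= -addrA; congr (_ + (_ + _)).
- apply: eq_bigr => b _; apply: eq_bigl => w; exact: ur_adj_old.
- rewrite (exchange_big_dep xpredT) //=; apply: eq_bigr => i _.
  by apply: big_pred1 => b; rewrite ur_adj_x.
under eq_bigr => i _.
  rewrite sumW (big_pred1 (wF i)); last by move=> w; rewrite ur_adj_s.
  rewrite (eq_bigl xpredT); last by move=> j; rewrite ur_adj_sx.
  rewrite (sum_ord2 i); over.
by rewrite !big_split.
Qed.

Hypotheses (PG : planar G) (PG' : planar G').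

Lemma urban_rotB_F i : rotB (bF i) (wF (rev_ord i)) = wF i.
Proof. by have := ur_rotB_F D (rev_ord i); rewrite rev_ordK. Qed.

(** A right face is the left face of the next edge around [b], so [ur_lface_F] applies; injectivity
    of the rotation then identifies [w]. *)
Lemma urban_rface_F b w : adj b w ->
  (rface b w == F) = [exists i, (b == bF (rev_ord i)) && (w == wF i)].
Proof.
move=> bw; rewrite /rface (ur_lface_F D) ?adj_rotB //.
apply/existsP/existsP=> [] [i /andP[/eqP bi /eqP wi]].
  exists (rev_ord i); rewrite rev_ordK bi eqxx /=.
  apply/eqP/(rotB_inj PG bw); first by rewrite bi ur_adj_bw.
  by rewrite wi bi urban_rotB_F.
by exists (rev_ord i); rewrite bi wi ur_rotB_F !eqxx.
Qed.

Lemma urban_face_F i :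
  [/\ lface (bF i) (wF i) = F, rface (bF (rev_ord i)) (wF i) = F,
      rface (bF i) (wF i) != F & lface (bF (rev_ord i)) (wF i) != F].
Proof.
split.
- apply/eqP; rewrite (ur_lface_F D) ?ur_adj_bw //.
  by apply/existsP; exists i; rewrite !eqxx.
- apply/eqP; rewrite urban_rface_F ?ur_adj_bw //.
  by apply/existsP; exists i; rewrite !eqxx.
- rewrite urban_rface_F ?ur_adj_bw //; apply/existsP=> -[j /andP[]].
  rewrite (inj_eq (@ur_b_inj _ _ D)) (inj_eq (@ur_w_inj _ _ D)) => /eqP-> /eqP/esym/eqP.
  by rewrite eq_sym rev_ord2_neq.
rewrite (ur_lface_F D) ?ur_adj_bw //; apply/existsP=> -[j /andP[]].
rewrite (inj_eq (@ur_b_inj _ _ D)) (inj_eq (@ur_w_inj _ _ D)) => /eqP<- /eqP/esym/eqP.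
by rewrite rev_ord2_neq.
Qed.

(** [F] is on the left of two of its four sides, so the constant terms of [face_sum] cancel and only
    the four signs remain. *)
Lemma urban_sign_F eps : kasteleyn eps ->
  let e i j := eps (bF i) (wF j) in
  e ord0 ord0 (+) e ord0 ord_max (+) e ord_max ord0 (+) e ord_max ord_max.
Proof.
move=> /(kasteleynP PG)/(_ F (ur_F_bounded D)).
rewrite /face_sum urban_sum_old big1 ?add0r => [|b _]; last first.
  apply: big1 => w /andP[bw not_quad].
  rewrite (ur_lface_F D) // urban_rface_F //.
  suff no_quad i j : (b == bF i) && (w == wF j) = false.
    by rewrite 2?(introF existsP) // => -[i]; rewrite no_quad.
  apply: contraNF not_quad => /andP[/eqP-> /eqP->].
  by rewrite /quad_edge !codom_f.
rewrite (sum_ord2 ord0); have [-> ->] := rev_ord2.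
have [l0 r0 /negPf p0 /negPf q0] := urban_face_F ord0.
have [l1 r1 /negPf p1 /negPf q1] := urban_face_F ord_max.
have [rev0 rev1] := rev_ord2; rewrite rev0 rev1 in r0 q0 r1 q1.
rewrite l0 r0 p0 q0 l1 r1 p1 q1 eqxx /=.
by do 4!case: (eps _ _).
Qed.

Lemma urban_rface_old b w : adj b w -> ~~ quad b w ->
  rface (oldB b) (oldW w) = oldF (rface b w).
Proof.
move=> bw not_quad; have bw' := adj_rotB PG bw; rewrite /rface.
have [/codomP[i def_b]|b_old] := boolP (b \in codom bF); last first.
  rewrite (ur_rotB_old (u := D)) // ur_lface_old // /quad_edge.
  by rewrite (negPf b_old).
subst b; have w_old : w \notin codom wF by move: not_quad; rewrite /quad_edge codom_f.
have w_neq j : w != wF j by apply: contraNneq w_old => ->; apply: codom_f.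
have := ur_rotB_b (u := D) bw (w_neq _); rewrite (negPf w_old) => ->.
have [/codomP[j rot_w]|rot_old] := boolP (rotB _ _ \in codom wF); last first.
  by rewrite ur_lface_old // /quad_edge (negPf rot_old) andbF.
(* The predecessor of [wF i] around [bF i] is [wF (rev_ord i)]; an edge outside the quadrilateral
   can thus only be followed by the other corner. *)
rewrite ur_lface_bx rot_w; congr (oldF (lface _ (wF _))).
apply/esym/neq_rev_ord2; apply: contraNneq (w_neq (rev_ord i)) => ji.
by apply/eqP/(rotB_inj PG bw (ur_adj_bw D _ _)); rewrite rot_w ji urban_rotB_F.
Qed.

Lemma urban_new_faces i :
  [/\ rface (oldB (bF i)) (x i) = oldF (rface (bF i) (wF i)),
      rface (s i) (oldW (wF i)) = oldF (rface (bF i) (wF i)),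
      rface (s i) (x i) = oldF F
    & rface (s i) (x (rev_ord i)) = oldF (lface (bF (rev_ord i)) (wF i))].
Proof.
have [rot1 rot2 rot3] := ur_rotB_s D i; split.
(* Read off around [x i], where [s i] is followed by [oldB (bF i)]. *)
- have [_ _ <-] := ur_rotW_x D i; rewrite (face_walk PG') ?ur_adj_sx //.
  exact: ur_lface_sx.
- by rewrite /rface rot1 ur_lface_sx.
- by rewrite /rface rot2 ur_lface_small.
by rewrite /rface rot3 ur_lface_sw.
Qed.

(** Compared with the side from [bF j] to [wF i], the edge from [s i] to [x j] has its left and
    right faces exchanged. Negating the sign compensates for this, so both edges contribute alike to
    every face. *)
Lemma urban_kasteleyn eps : kasteleyn eps ->
  exists2 eps', kasteleyn eps' &
    [/\ forall b w, eps' (oldB b) (oldW w) = eps b w,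
        forall b i, eps' (oldB b) (x i) = false,
        forall i w, eps' (s i) (oldW w) = false
      & forall i j, eps' (s i) (x j) = ~~ eps (bF j) (wF i)].
Proof.
move=> ke; have [newB oldBK newBK] := ur_black_bij D.
have [newW oldWK newWK] := ur_white_bij D.
pose eps' b' w' :=
  match newB b', newW w' with
  | inl b, inl w => eps b w
  | inr i, inr j => ~~ eps (bF j) (wF i)
  | _, _ => false
  end.
have newB_old b : newB (oldB b) = inl b := oldBK (inl b).
have newB_s i : newB (s i) = inr i := oldBK (inr i).
have newW_old w : newW (oldW w) = inl w := oldWK (inl w).
have newW_x i : newW (x i) = inr i := oldWK (inr i).
have eps'_old b w : eps' (oldB b) (oldW w) = eps b w by rewrite /eps' newB_old newW_old.
have eps'_x b i : eps' (oldB b) (x i) = false by rewrite /eps' newB_old newW_x.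
have eps'_s i w : eps' (s i) (oldW w) = false by rewrite /eps' newB_s newW_old.
have eps'_sx i j : eps' (s i) (x j) = ~~ eps (bF j) (wF i) by rewrite /eps' newB_s newW_x.
exists eps' => //.
apply: (kasteleyn_transport PG PG' (ur_face_bij D) (ur_outer D)) ke => f.
have [newF oldFK _] := ur_face_bij D.
rewrite /face_sum urban_sum_new urban_sum_old; congr (_ + _).
  apply: eq_bigr => b _; apply: eq_bigr => w /andP[bw not_quad].
  by rewrite ur_lface_old // urban_rface_old // !(can_eq oldFK) eps'_old.
under eq_bigr => i _.
  have [-> -> -> ->] := urban_new_faces i.
  rewrite ur_lface_bx ur_lface_sw ur_lface_sx ur_lface_small !(can_eq oldFK).
  rewrite eps'_x eps'_s !eps'_sx !andbT !andbF !addr0; over.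
rewrite big_split /= [X in X + _](_ : _ = 0) ?add0r.
  apply: eq_bigr => i _; have [-> -> _ _] := urban_face_F i.
  by do 3!case: (_ == f); case: (eps _ _); case: (eps _ _).
(* The connecting edges have sign +1 and contribute to their left faces; the one at [x i] and the
   one at [s (rev_ord i)] share this face and cancel. *)
rewrite big_split /= (reindex_inj rev_ord_inj) /=.
under eq_bigr do rewrite rev_ordK.
rewrite -big_split big1 //= => i _.
by case: (_ == f).
Qed.

End UrbanRenewal.

(** * Exact transformation of signed weights, then passage to gauge classes *)

Lemma elementary_move_signed_weight (k : fieldType) (V : lmodType k) (G G' : bimap)
    (e : elementary_move G G') (c : configuration V G) (c' : configuration V G') eps :
  planar G -> planar G' -> elementary_config e c c' -> kasteleyn eps ->
  exists2 eps', kasteleyn eps' &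
    elementary_weight e (signed_weight eps (coef c)) (signed_weight eps' (coef c')).
Proof.
move=> PG PG'; case: e => D /=.
- move=> [unitM _ K_s K_x K_old] ke.
  have [eps' ke' [eps'_old eps'_x eps'_s eps'_sx]] := urban_kasteleyn D PG PG' ke.
  set M := (\matrix_(i, j) _) in unitM K_s.
  pose e i j := eps (ur_b D i) (ur_w D j).
  have M00: M ord0 ord0 != 0 by rewrite mxE coef_neq0 ur_adj_bw.
  have [Delta0 inv_eq] := inverse_signed_mx2 (e := e) unitM M00 (urban_sign_F D PG ke).
  rewrite !mxE in Delta0.
  exists eps' => //; split=> [|i j|i|i|b w bw not_quad] //.
  + have [_ K_sx] := K_s i; rewrite /signed_weight eps'_sx K_sx.
    by have := inv_eq i j; rewrite !mxE.
  + by rewrite /signed_weight eps'_x K_x expr0 mulr1.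
  + by have [K_sw _] := K_s i; rewrite /signed_weight eps'_s K_sw expr0 mulr1.
  by rewrite /signed_weight eps'_old K_old.
- move=> [_ _ K_new K_copy K_old] ke.
  have [eps' ke' [eps'_old eps'_new eps'_copy]] := white_split_kasteleyn D PG PG' ke.
  exists eps' => //; split=> [||b w bw]; rewrite /signed_weight.
  + by rewrite eps'_new K_new expr0 mulr1.
  + by rewrite eps'_copy K_copy expr1 mulrNN mulr1.
  by rewrite eps'_old // K_old.
move=> [_ K_new K_copy K_old] ke.
have [eps' ke' [eps'_old eps'_new eps'_copy]] := black_split_kasteleyn D PG PG' ke.
exists eps' => //; split=> [||b w bw]; rewrite /signed_weight.
- by rewrite eps'_new K_new expr1 mulrNN mulr1.
- by rewrite eps'_copy K_copy expr0 mulr1.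
by rewrite eps'_old // K_old.
Qed.

(** Signs on [G] are those witnessing the weight of [c], signs on [G'] are transported from them;
    the given weight on [G'] may use other signs, which changes it only by a gauge. *)
Lemma elementary_move_weight (k : fieldType) (V : lmodType k) (G G' : bimap)
    (e : elementary_move G G') (c c1 : configuration V G) (c' c1' : configuration V G')
    (wt : weight k G) (wt' : weight k G') :
  planar G -> planar G' ->
  gauge_config c c1 -> gauge_config c' c1' -> elementary_config e c1 c1' ->
  associated_weight c wt -> associated_weight c' wt' ->
  exists (wt1 : weight k G) (wt1' : weight k G'),
    [/\ gauge_weight wt wt1, gauge_weight wt' wt1' & elementary_weight e wt1 wt1'].
Proof.
move=> PG PG' cc1 cc1' e_c as_wt as_wt'; have [eps ke _] := as_wt.
have [eps' ke' e_wt] := elementary_move_signed_weight PG PG' e_c ke.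
exists (signed_weight eps (coef c1)), (signed_weight eps' (coef c1')).
split=> //; first exact: associated_weight_kasteleyn PG cc1 as_wt ke.
exact: associated_weight_kasteleyn PG' cc1' as_wt' ke'.
Qed.

Theorem proposition3p2 (k : fieldType) (V : lmodType k) (G G' : plane_graph)
    (m : local_move G G')
    (c : configuration V G) (c' : configuration V G')
    (wt : weight k G) (wt' : weight k G') :
  config_transformed m c c' ->
  associated_weight c wt -> associated_weight c' wt' ->
  weight_transformed m wt wt'.
Proof.
have [PG PG'] := (plane_graphP G, plane_graphP G').
case: m => e [c1 [c1' [cc1 cc1' e_c]]] as_wt as_wt'.
  exact: elementary_move_weight PG PG' cc1 cc1' e_c as_wt as_wt'.
(* A backward move is a forward one with the two graphs exchanged. *)
have [wt1' [wt1 [wt'1 wt01 e_wt]]] :=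
  elementary_move_weight PG' PG cc1' cc1 e_c as_wt' as_wt.
by exists wt1, wt1'.
Qed.
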